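(* Let $p\ge 5$ be a prime, let $C,D\in\mathbb{F}_p$, let $$f(x,y,z)=x^2+y^2+z^2-xyz+C(x+y+z)-D,$$ and put $D_\bullet=4-2C-\frac{C^2}{4}\in\mathbb{F}_p$. Let $N_1(f)$ be the number of $(x,y,z)\in\mathbb{F}_p^3$ with $f(x,y,z)=0$ and $(\partial_z f)(x,y,z)=0$. Then the following hold. (i) If $D=D_\bullet$, then $N_1(f)=\big(3+\llbracket C=0\rrbracket\big)p-4+\llbracket C=8\rrbracket$. (ii) If $D\ne D_\bullet$, then $$N_1(f)=p-3+\sum_{x\in\mathbb{F}_p}\sigma(\lambda(x)),$$ where $\lambda(x)$ is the cubic $$\lambda(x)=x^3-(D-D_\bullet)x^2+\Big(\frac{C-8}{2}\cdot x+4(D-D_\bullet)\Big)^2.$$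
   Context: $\sigma:\mathbb{F}_p\to\{-1,0,1\}\subset\mathbb{Z}$ denotes the quadratic character: $\sigma(a)=1$ if $a$ is a nonzero square, $\sigma(a)=-1$ if $a$ is a non-square, $\sigma(0)=0$. The Iverson bracket $\llbracket \mathcal{S}\rrbracket$ is $1$ if the statement $\mathcal{S}$ is true and $0$ otherwise; equalities such as $C=8$ are in $\mathbb{F}_p$. *)

(* Defs.v *)
From mathcomp Require Import all_boot all_order all_algebra.
From mathcomp Require Import mpoly.

Set Implicit Arguments.
Unset Strict Implicit.
Unset Printing Implicit Defensive.

Import GRing.Theory.
Local Open Scope ring_scope.

Definition sigma (p : nat) (a : 'F_p) : int :=
  if a == 0 then 0 else if [exists b : 'F_p, b ^+ 2 == a] then 1 else -1.

Definition ix : 'I_3 := @Ordinal 3 0 isT.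
Definition iy : 'I_3 := @Ordinal 3 1 isT.
Definition iz : 'I_3 := @Ordinal 3 2 isT.

Definition fpoly (p : nat) (C D : 'F_p) : {mpoly 'F_p[3]} :=
  'X_ix ^+ 2 + 'X_iy ^+ 2 + 'X_iz ^+ 2 - 'X_ix * 'X_iy * 'X_iz
  + C%:MP * ('X_ix + 'X_iy + 'X_iz) - D%:MP.

Definition N1 (p : nat) (f : {mpoly 'F_p[3]}) : nat :=
  #|[set v : {ffun 'I_3 -> 'F_p} | (f.@[v] == 0) && ((f^`M(iz)).@[v] == 0)]|.

Definition Dbullet (p : nat) (C : 'F_p) : 'F_p := 4 - 2 * C - C ^+ 2 / 4.

Definition lambda (p : nat) (C D x : 'F_p) : 'F_p :=
  x ^+ 3 - (D - Dbullet C) * x ^+ 2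
  + ((C - 8) / 2 * x + 4 * (D - Dbullet C)) ^+ 2.

(* Main.v *)
Require Import Defs.
From mathcomp Require Import all_boot all_order all_algebra.
From mathcomp Require Import mpoly.
From mathcomp Require Import ring.

Set Implicit Arguments.
Unset Strict Implicit.
Unset Printing Implicit Defensive.

Import GRing.Theory.
Local Open Scope ring_scope.

(* On the surface [2 z = x y - C], [4 f] is a polynomial of degree at most 2 in
   [y], so [N_1(f)] is the sum over [x] of its number of roots.  Put
   [E = D - D_bullet].  For [x <> 2, -2] its quarter discriminant is
   [delta x = (x+2)^2 (2x-4+C)^2 + 4 E (4-x^2)], giving [1 + sigma (delta x)]
   roots; for [x = 2, -2] the quadratic term vanishes.  If [E = 0], [delta] is a
   square.  Otherwise the substitution [x + 2 = 4 E / t] turns it into [lambda t]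
   times the square [(8 E / t^2)^2]. *)

Lemma natr_Fp_neq0 (p n : nat) : prime p -> (0 < n < p)%N ->
  n%:R != 0 :> 'F_p.
Proof.
move=> p_pr /andP[n_gt0 n_ltp]; rewrite -(dvdn_pcharf (pchar_Fp p_pr)).
by rewrite gtnNdvd.
Qed.

Lemma four_neq0 (F : fieldType) : 2 != 0 :> F -> 4 != 0 :> F.
Proof. by move=> two0; rewrite (natrM _ 2 2) mulf_neq0. Qed.

Lemma two_eqN2 (F : fieldType) : 2 != 0 :> F -> (2 == - 2 :> F) = false.
Proof.
by move=> /four_neq0/negbTE <-; rewrite -subr_eq0 opprK -natrD.
Qed.

Lemma sigma_mul_sqr (p : nat) (a b : 'F_p) : b != 0 ->
  sigma (b ^+ 2 * a) = sigma a.
Proof.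
move=> b0; rewrite /sigma mulf_eq0 expf_eq0 (negbTE b0) /=.
case: (a == 0) => //; congr (if _ then _ else _).
apply/existsP/existsP => -[c /eqP Hc].
  by exists (c / b); rewrite expr_div_n Hc mulrC mulKf // expf_eq0.
by exists (b * c); rewrite exprMn Hc.
Qed.

Lemma sigma_sqr (p : nat) (a : 'F_p) : sigma (a ^+ 2) = (a != 0)%:Z.
Proof.
rewrite /sigma expf_eq0 /=; case: eqVneq => //= _.
by case: existsP => // -[]; exists a.
Qed.

Lemma card_sqrt (p : nat) (d : 'F_p) : 2 != 0 :> 'F_p ->
  #|[set s : 'F_p | s ^+ 2 == d]|%:Z = 1 + sigma d.
Proof.
move=> two0; rewrite /sigma; case: eqVneq => [->|d0].
  rewrite (_ : [set _ : 'F_p | _] = [set 0]) ?cards1 //.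
  by apply/setP=> s; rewrite !inE expf_eq0.
case: existsP => [[b /eqP Hb]|Nb].
  rewrite (_ : [set _ : 'F_p | _] = [set b; - b]); last first.
    by apply/setP=> s; rewrite !inE -Hb eqf_sqr.
  rewrite cards2 -addr_eq0 -mulr2n -mulr_natl mulf_neq0 //.
  by apply: contraNneq d0 => b0; rewrite -Hb b0 expr0n.
rewrite (_ : [set _ : 'F_p | _] = set0) ?cards0 //.
by apply/setP=> s; rewrite !inE; apply/negP => Hs; apply: Nb; exists s.
Qed.

(** Completing the square: the injection [y |-> a * y + b] carries the roots to the square roots of
    the quarter discriminant. *)
Lemma card_quadratic (p : nat) (a b c : 'F_p) : 2 != 0 :> 'F_p -> a != 0 ->
  #|[set y : 'F_p | a * y ^+ 2 + 2 * b * y + c == 0]|%:Z =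
    1 + sigma (b ^+ 2 - a * c).
Proof.
move=> two0 a0; rewrite -card_sqrt //.
have inj : injective (fun y : 'F_p => a * y + b).
  by move=> y z /addIr /(mulfI a0).
rewrite -[in RHS](card_preimset _ inj); congr Posz; apply: eq_card => y.
rewrite !inE -[RHS]subr_eq0.
have -> : (a * y + b) ^+ 2 - (b ^+ 2 - a * c)
  = a * (a * y ^+ 2 + 2 * b * y + c) by ring.
by rewrite mulf_eq0 (negbTE a0).
Qed.

Lemma card_linear (p : nat) (a c : 'F_p) : prime p ->
  #|[set y : 'F_p | a * y + c == 0]|%:Z =
    if a == 0 then (c == 0)%:Z * p%:Z else 1.
Proof.
move=> p_pr; case: eqVneq => [->|a0].
  case: eqVneq => [->|c0].
    by rewrite mul1r -[in RHS](card_Fp p_pr) -cardsT; congr Posz.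
  rewrite (_ : [set _ : 'F_p | _] = set0) ?cards0 ?mul0r //.
  by apply/setP=> y; rewrite !inE mul0r add0r (negbTE c0).
rewrite (_ : [set _ : 'F_p | _] = [set - c / a]) ?cards1 //.
apply/setP=> y; rewrite !inE addr_eq0 -[RHS](inj_eq (mulIf a0)) divfK //.
by rewrite mulrC.
Qed.

Lemma sum_pred1 (T : finType) (a : T) : \sum_(x : T) (x == a)%:Z = 1.
Proof.
rewrite (bigD1 a) //= eqxx big1 // => x /negbTE -> //.
Qed.

(** The equation is [4 f = 0] after substituting [z = (x y - C) / 2], with the constant term
    rearranged to expose [D - Dbullet C]. *)
Definition fibre (p : nat) (C D x : 'F_p) : {set 'F_p} :=
  [set y | (4 - x ^+ 2) * y ^+ 2 + 2 * (C * (x + 2)) * y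
           + 4 * ((x + 2) * (x - 2 + C) - (D - Dbullet C)) == 0].

Lemma mderivXU (n : nat) (R : nzRingType) (i j : 'I_n) :
  ('X_i : {mpoly R[n]})^`M(j) = (i == j)%:R%:MP.
Proof.
rewrite mderivX mnm1E; case: eqVneq => [->|_]; last by rewrite scale0r mpolyC0.
have -> : (U_(j) - U_(j))%MM = 0%MM :> 'X_{1.. n}.
  by apply/mnmP=> k; rewrite mnmE subnn mnm0E.
by rewrite scale1r mpolyX0.
Qed.

Lemma N1_fibres (p : nat) (C D : 'F_p) : 2 != 0 :> 'F_p ->
  (N1 (fpoly C D))%:Z = \sum_(x : 'F_p) #|fibre C D x|%:Z.
Proof.
move=> two0.
(* The third coordinate is the unique solution of [2 z - x y + C = 0], which is the vanishing of the
   partial derivative in [z]. *)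
pose h (u : 'F_p * 'F_p) : {ffun 'I_3 -> 'F_p} := [ffun i : 'I_3 =>
  if i == ix then u.1 else if i == iy then u.2 else (u.1 * u.2 - C) / 2].
have h_inj : injective h.
  move=> [x y] [x' y'] /ffunP E.
  by have := E ix; have := E iy; rewrite !ffunE /= => -> ->.
pose S := [set u : 'F_p * 'F_p | u.2 \in fibre C D u.1].
have -> : N1 (fpoly C D) = #|S|.
  rewrite -(card_imset _ h_inj) /N1; apply: eq_card => v.
  have four0 := four_neq0 two0.
  rewrite inE /fpoly.
  rewrite !(mderivD, mderivB, mderivN, mderivM, mderivC, mderivXU, expr2).
  rewrite !(mevalD, mevalB, mevalN, mevalM, mevalC, mevalXU) /=.
  apply/andP/imsetP => [[/eqP F0 /eqP G0]|[[x y]]].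
    have vz : v iz = (v ix * v iy - C) / 2.
      by apply: (mulIf two0); rewrite divfK //; apply/eqP;
        rewrite -subr_eq0 -G0; apply/eqP; ring.
    exists (v ix, v iy).
      rewrite !inE /=; apply/eqP; rewrite -[RHS](mulr0 4) -F0 vz /Dbullet.
      by field; rewrite two0 four0.
    apply/ffunP=> -[[|[|[|//]]] Hi]; rewrite ffunE /= -?vz;
      congr (v _); exact: val_inj.
  rewrite !inE /= => /eqP H ->; rewrite !ffunE /=; split; apply/eqP.
    apply: (mulfI four0); rewrite mulr0 -H /Dbullet.
    by field; rewrite two0 four0.
  by field; rewrite two0.
rewrite -(big_morph Posz PoszD (erefl _)) -sum1_card; congr Posz.
under [RHS]eq_bigr => x _ do rewrite -sum1_card.
by rewrite pair_big_dep; apply: eq_bigl => -[x y]; rewrite inE.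
Qed.

Lemma card_fibre (p : nat) (C D x : 'F_p) : 2 != 0 :> 'F_p ->
  x != 2 -> x != -2 ->
  #|fibre C D x|%:Z = 1 + sigma ((x + 2) ^+ 2 * (2 * x - 4 + C) ^+ 2
                                 + 4 * (D - Dbullet C) * (4 - x ^+ 2)).
Proof.
move=> two0 x2 xN2; rewrite card_quadratic //.
  (* The part free of [D - Dbullet C] is [(x+2)^2 (C^2 + 4 (x-2) (x-2+C))], and its second factor is
     [(2 (x-2) + C)^2]. *)
  by congr (1 + sigma _); ring.
have -> : 4 - x ^+ 2 = - ((x - 2) * (x + 2)) by ring.
by rewrite oppr_eq0 mulf_neq0 // ?subr_eq0 ?addr_eq0.
Qed.

Lemma card_fibre2 (p : nat) (C D : 'F_p) : prime p -> 2 != 0 :> 'F_p ->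
  #|fibre C D 2|%:Z = if C == 0 then (D == Dbullet C)%:Z * p%:Z else 1.
Proof.
move=> p_pr two0; have four0 := four_neq0 two0.
have -> : fibre C D 2 = [set y | (2 * 4 * C) * y
    + 4 * (4 * C - (D - Dbullet C)) == 0].
  by apply/setP=> y; rewrite !inE; congr (_ == 0); ring.
rewrite card_linear // !mulf_eq0 (negbTE two0) (negbTE four0) /=.
by case: eqVneq => // ->; rewrite mulr0 sub0r oppr_eq0 subr_eq0.
Qed.

(** At [x = -2] the linear coefficient, a multiple of [x + 2], vanishes as well, so the fibre is
    everything or empty. *)
Lemma card_fibreN2 (p : nat) (C D : 'F_p) : prime p -> 2 != 0 :> 'F_p ->
  #|fibre C D (- 2)|%:Z = (D == Dbullet C)%:Z * p%:Z.
Proof.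
move=> p_pr two0; have four0 := four_neq0 two0.
have -> : fibre C D (- 2) = [set y | 0 * y - 4 * (D - Dbullet C) == 0].
  by apply/setP=> y; rewrite !inE; congr (_ == 0); ring.
by rewrite card_linear // eqxx oppr_eq0 mulf_eq0 (negbTE four0) subr_eq0.
Qed.

Lemma sum_card_fibre_degenerate (p : nat) (C : 'F_p) :
  prime p -> 2 != 0 :> 'F_p ->
  \sum_(x : 'F_p) #|fibre C (Dbullet C) x|%:Z =
    (3 + (C == 0)%:Z) * p%:Z - 4 + (C == 8)%:Z.
Proof.
move=> p_pr two0; have N22 := two_eqN2 two0.
(* The root of [2 x - 4 + C]: the only place other than [-2] where the discriminant, now a square,
   can vanish. It collides with an exceptional abscissa exactly when [C = 0] or [C = 8], whence the
   two brackets. *)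
pose x0 : 'F_p := (4 - C) / 2.
have x0_2 : (2 == x0) = (C == 0).
  rewrite eq_sym -subr_eq0 (_ : x0 - 2 = C * - 2^-1); last by rewrite /x0; field.
  by rewrite mulf_eq0 oppr_eq0 invr_eq0 (negbTE two0) orbF.
have x0_N2 : (- 2 == x0) = (C == 8).
  rewrite eq_sym -subr_eq0 (_ : x0 - - 2 = (C - 8) * - 2^-1);
    last by rewrite /x0; field.
  by rewrite mulf_eq0 oppr_eq0 invr_eq0 (negbTE two0) orbF subr_eq0.
(* [2 - (x == x0)] is the generic value; the other terms correct it at [-2], [2]. *)
rewrite (eq_bigr (fun x => 2 - (x == x0)%:Z
    + (p%:Z - 2 + (C == 8)%:Z) * (x == - 2)%:Z
    + ((C == 0)%:Z * p%:Z - 1) * (x == 2)%:Z)).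
  rewrite !big_split /= sumrN -!mulr_sumr !sum_pred1 sumr_const card_Fp //.
  by rewrite -mulr_natr natz; ring.
move=> x _; case: (eqVneq x 2) => [->|x2].
  rewrite card_fibre2 // x0_2 N22 eqxx.
  by case: eqP => _ /=; ring.
case: (eqVneq x (- 2)) => [->|xN2].
  by rewrite card_fibreN2 // x0_N2 eqxx; case: eqP => _ /=; ring.
rewrite card_fibre // subrr mulr0 mul0r addr0 -exprMn sigma_sqr.
rewrite (_ : _ * (2 * x - 4 + C) = 2 * (x + 2) * (x - x0)); last first.
  by rewrite /x0; field.
rewrite !mulf_eq0 (negbTE two0) addr_eq0 (negbTE xN2) subr_eq0 /=.
by case: eqP => _ /=; ring.
Qed.

Lemma sum_card_fibre (p : nat) (C D : 'F_p) :
  prime p -> 2 != 0 :> 'F_p -> D != Dbullet C ->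
  \sum_(x : 'F_p) #|fibre C D x|%:Z =
    p%:Z - 3 + \sum_(x : 'F_p) sigma (lambda C D x).
Proof.
move=> p_pr two0 ND; have four0 := four_neq0 two0.
pose E := D - Dbullet C; have E0 : E != 0 by rewrite subr_eq0.
have N22 := two_eqN2 two0.
pose delta x := (x + 2) ^+ 2 * (2 * x - 4 + C) ^+ 2 + 4 * E * (4 - x ^+ 2).
(* The generic formula needs a correction of [-1] at each exceptional point: at [2], [delta] is
   [(4 C)^2] and the fibre has one point or none according to [C]; at [-2], [delta] is [0] and the
   fibre is empty. *)
have card_delta x :
    #|fibre C D x|%:Z = 1 - (x == 2)%:Z - (x == - 2)%:Z + sigma (delta x).
  case: (eqVneq x 2) => [->|x2].
    rewrite card_fibre2 // N22 (negbTE ND) mul0r.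
    rewrite (_ : delta 2 = (4 * C) ^+ 2); last by rewrite /delta; ring.
    by rewrite sigma_sqr mulf_eq0 (negbTE four0); case: eqP.
  case: (eqVneq x (- 2)) => [->|xN2]; last by rewrite card_fibre //; ring.
  rewrite card_fibreN2 // (negbTE ND) (_ : delta (- 2) = 0) /delta; last by ring.
  by rewrite /sigma eqxx.
(* Since [0^-1 = 0], [h 0 = -2] and [h] is a bijection of the whole field. *)
pose h (t : 'F_p) := 4 * E / t - 2.
have h_inj : injective h.
  by move=> s t /addIr /mulfI-/(_ (mulf_neq0 four0 E0)) /invr_inj.
(* At [t = 0] the two sides differ by one: [delta (-2)] is [0], whereas [lambda] takes the nonzero
   square value [(4 E)^2]. *)
have sigma_h t : sigma (delta (h t)) = sigma (lambda C D t) - (t == 0)%:Z.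
  case: (eqVneq t 0) => [->|t0].
    rewrite (_ : delta (h 0) = 0); last by rewrite /delta /h invr0; ring.
    rewrite (_ : lambda C D 0 = (4 * E) ^+ 2); last by rewrite /lambda -/E; ring.
    by rewrite sigma_sqr mulf_neq0 // /sigma eqxx.
  rewrite subr0 -[RHS](sigma_mul_sqr _ (b := 8 * E / t ^+ 2)).
    by congr sigma; rewrite /delta /h /lambda -/E; field; rewrite t0 two0.
  by rewrite (natrM _ 2 4) !mulf_neq0 // invr_eq0 expf_neq0.
(* The corrections at [x = 2], [x = -2] and [t = 0] account for the [-3]. *)
rewrite (eq_bigr _ (fun x _ => card_delta x)) !big_split /= !sumrN !sum_pred1.
rewrite [X in _ + X = _](reindex_inj h_inj) (eq_bigr _ (fun t _ => sigma_h t)).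
rewrite big_split /= sumrN sum_pred1 sumr_const card_Fp // natz; ring.
Qed.

Theorem theorem7p1 (p : nat) (p_prime : prime p) (p_ge5 : (5 <= p)%N)
    (C D : 'F_p) :
  (D = Dbullet C ->
     (N1 (fpoly C D))%:Z =
       (3 + (C == 0)%:Z) * p%:Z - 4 + (C == 8)%:Z) /\
  (D <> Dbullet C ->
     (N1 (fpoly C D))%:Z =
       p%:Z - 3 + \sum_(x : 'F_p) sigma (lambda C D x)).
Proof.
have two0 : 2 != 0 :> 'F_p.
  by apply: natr_Fp_neq0 => //; apply: leq_trans p_ge5.
rewrite N1_fibres //; split=> [->|/eqP ND].
  exact: sum_card_fibre_degenerate.
exact: sum_card_fibre.
Qed.
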